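(* Let $X$ be a Banach space with $\dim(X)>1$ and let $x\in S_X$ be a LUR point. Then $x$ is not an AD point.
   Context: Banach spaces are over $\mathbb{K}$ ($\mathbb{R}$ or $\mathbb{C}$); $B_X$, $S_X$ denote the closed unit ball and the unit sphere of $X$; $\mathbb{T}=\{\theta\in\mathbb{K}:|\theta|=1\}$. An element $x\in B_X$ is a LUR point if for every $\varepsilon>0$ there is $\delta>0$ such that for every $y\in B_X$, $\left\|\frac{x+y}{2}\right\|>1-\delta$ implies $\|x-y\|\leq\varepsilon$. A slice of $B_X$ is a set of the form $\{y\in B_X:\mathrm{Re}\,x^*(y)>\sup\mathrm{Re}\,x^*(B_X)-\alpha\}$ with $x^*\in X^*\setminus\{0\}$ and $\alpha>0$. A point $x\in S_X$ is an AD point if $\sup_{y\in S}\max_{\theta\in\mathbb{T}}\|x+\theta y\|=2$ for every slice $S$ of $B_X$. *)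

(* Defs.v *)
From HB Require Import structures.
From mathcomp Require Import all_boot all_order all_algebra.
From mathcomp Require Import complex.
From mathcomp Require Import all_classical all_reals all_analysis.

Set Implicit Arguments.
Unset Strict Implicit.
Unset Printing Implicit Defensive.

Import Order.TTheory GRing.Theory Num.Theory.
Import numFieldNormedType.Exports.

Local Open Scope classical_set_scope.
Local Open Scope complex_scope.
Local Open Scope ring_scope.

Variant scalars := RealScalars | ComplexScalars.

Definition scalar_field (R : realType) (s : scalars) : numFieldType :=
  match s with
  | RealScalars => R
  | ComplexScalars => R[i]
  end.

Definition re (R : realType) (s : scalars) : scalar_field R s -> R :=
  match s return scalar_field R s -> R with
  | RealScalars => fun z => z
  | ComplexScalars => fun z => complex.Re z
  end.

Definition torus (R : realType) (s : scalars) : set (scalar_field R s) :=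
  [set theta | `|theta| = 1].

Section BanachGeometry.
Context {R : realType} {s : scalars}.
Local Notation K := (scalar_field R s).
Context {X : completeNormedModType K}.
Implicit Types (x y : X) (S : set X) (f : {linear X -> K^o}).

(* MathComp norms take values in the scalar field; [`|x|] is a nonnegative
   real element of K, so taking its real part loses no information. *)
Definition rnorm x : R := re `|x|.

Definition unit_ball : set X := [set y | rnorm y <= 1].

Definition unit_sphere : set X := [set y | rnorm y = 1].

Definition lin_indep (n : nat) (v : 'I_n -> X) : Prop :=
  forall a : 'I_n -> K, \sum_(i < n) a i *: v i = 0 -> forall i, a i = 0.

(* [X] may be infinite-dimensional, so dimension > n is expressed by the
   existence of n + 1 linearly independent vectors. *)
Definition dim_gt (n : nat) : Prop := exists v : 'I_n.+1 -> X, lin_indep v.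

Definition LUR_point x : Prop :=
  unit_ball x /\
  forall eps : R, 0 < eps -> exists2 delta : R, 0 < delta &
    forall y, unit_ball y ->
      rnorm (2^-1 *: (x + y)) > 1 - delta -> rnorm (x - y) <= eps.

Definition slice f (alpha : R) : set X :=
  [set y | unit_ball y /\
           re (f y) > sup [set re (f z) | z in unit_ball] - alpha].

Definition is_slice S : Prop :=
  exists f, exists alpha : R,
    [/\ continuous f, (exists z, f z != 0), 0 < alpha & S = slice f alpha].

(* The maximum over the torus, which is compact, so that the supremum is
   attained. *)
Definition max_rotation x y : R :=
  sup [set rnorm (x + theta *: y) | theta in @torus R s].

Definition AD_point x : Prop :=
  unit_sphere x /\
  forall S, is_slice S -> sup [set max_rotation x y | y in S] = 2.

End BanachGeometry.

Arguments dim_gt {R s} X n.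

(* Main.v *)
(** Since [dim X > 1], there is a nonzero bounded functional [f] with
    [f x = 0]. If [x] is an AD point, every slice [S] of [f] contains points [y]
    with [`|x + theta *: y|] close to [2] for some unimodular [theta], so by the
    LUR property [theta *: y] is close to [x] and [`|f y| = `|f (theta *: y)|]
    is close to [`|f x| = 0]; but [re (f y)] is bounded away from [0] on a thin
    slice.

    The functionals come from the Hahn-Banach theorem, in the form "below every
    sublinear functional there is a minimal one, and minimal ones are linear". *)

Require Import Defs.
From HB Require Import structures.
From mathcomp Require Import all_boot all_order all_algebra.
From mathcomp Require Import complex lra ring.
From mathcomp Require Import all_classical all_reals all_analysis.

Set Implicit Arguments.
Unset Strict Implicit.
Unset Printing Implicit Defensive.

Import Order.TTheory GRing.Theory Num.Theory.
Import numFieldNormedType.Exports.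

Local Open Scope classical_set_scope.
Local Open Scope complex_scope.
Local Open Scope ring_scope.

(** * Sublinear functionals over the reals and the Hahn-Banach theorem *)

Section Sublinear.
Variables (R : realType) (V : lmodType R).
Implicit Types (p q : V -> R) (a t c : R) (x y v : V).

Definition sublinear p :=
  (forall x y, p (x + y) <= p x + p y) /\
  (forall (a : R) x, 0 <= a -> p (a *: x) <= a * p x).

(** The reverse inequality is homogeneity for the factor [a^-1] at [a *: x]. *)
Lemma sublinearZ p (a : R) x : sublinear p -> 0 < a -> p (a *: x) = a * p x.
Proof.
move=> [_ pZ] a0; have a0' := ltW a0; apply/eqP; rewrite eq_le pZ//=.
have := pZ a^-1 (a *: x); rewrite invr_ge0 a0' => /(_ isT).
by rewrite scalerA mulVf ?gt_eqF// scale1r ler_pdivlMl.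
Qed.

Lemma sublinearN p x : sublinear p -> - p (- x) <= p x.
Proof.
move=> p_sub; have [pD pZ] := p_sub.
have p0 : 0 <= p 0 by have := pD 0 0; rewrite addr0 => ?; lra.
by have := pD x (- x); rewrite subrr => ?; lra.
Qed.

Definition shave_values q v y :=
  [set q (y + t *: v) - t * q v | t in [set t : R | 0 <= t]].

(* The value at [- v] drops to [- q v], so that a minimal sublinear functional
   must be odd. *)
Definition shave q v y := inf (shave_values q v y).

(** Subadditivity splits [t *: v] as [(y + t *: v) + (- y)]. The bound does not depend on [t], so
    the infimum in [shave] is a genuine one. *)
Lemma shave_values_lbound q v y : sublinear q ->
  lbound (shave_values q v y) (- q (- y)).
Proof.
move=> q_sub _ [t /= t0 <-]; have [qD qZ] := q_sub.
have qtv : t * q v <= q (t *: v).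
  move: t0; rewrite le_eqVlt => /orP[/eqP<-|t0]; last by rewrite sublinearZ.
  by have := qD 0 0; rewrite scale0r mul0r addr0 => ?; lra.
by have := qD (y + t *: v) (- y); rewrite addrAC subrr add0r => ?; lra.
Qed.

Lemma shave_le q v y t : sublinear q -> 0 <= t ->
  shave q v y <= q (y + t *: v) - t * q v.
Proof.
move=> q_sub t0; apply: ge_inf; last by exists t.
by exists (- q (- y)); exact: shave_values_lbound.
Qed.

Lemma le_shave q v y c :
  (forall t, 0 <= t -> c <= q (y + t *: v) - t * q v) -> c <= shave q v y.
Proof.
move=> cq; apply: lb_le_inf; first by exists (q (y + 0 *: v) - 0 * q v), 0 => /=.
by move=> _ [t /= t0 <-]; exact: cq.
Qed.

Lemma shave_le_id q v y : sublinear q -> shave q v y <= q y.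
Proof.
by move=> q_sub; have := shave_le v y q_sub (lexx 0);
  rewrite scale0r mul0r addr0 subr0.
Qed.

Lemma shaveN q v : sublinear q -> shave q v (- v) <= - q v.
Proof.
move=> q_sub; have [qD qZ] := q_sub; have := shave_le v (- v) q_sub ler01.
have := qZ 0 0 (lexx 0).
by rewrite scale1r addNr mul1r scale0r mul0r => ?; lra.
Qed.

(** The shift parameters follow the vectors: those of [x] and [y] add up for [x + y], and [t] for
    [x] becomes [a * t] for [a *: x]. *)
Lemma sublinear_shave q v : sublinear q -> sublinear (shave q v).
Proof.
move=> q_sub; have [qD qZ] := q_sub; split=> [x y|a x].
  rewrite -lerBlDr; apply: le_shave => t t0.
  rewrite lerBlDr [leRHS]addrC -lerBlDr; apply: le_shave => r r0; rewrite lerBlDr.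
  apply: le_trans (shave_le v (x + y) q_sub (addr_ge0 r0 t0)) _.
  have := qD (x + t *: v) (y + r *: v).
  by rewrite scalerDl addrACA [t *: v + _]addrC mulrDl => ?; lra.
rewrite le_eqVlt => /orP[/eqP<-|a0].
  rewrite mul0r (le_trans (shave_le_id v _ q_sub))// scale0r.
  by have := qZ 0 0 (lexx 0); rewrite scale0r mul0r.
rewrite -ler_pdivrMl//; apply: le_shave => t t0; rewrite ler_pdivrMl//.
apply: le_trans (shave_le v _ q_sub (mulr_ge0 (ltW a0) t0)) _.
by rewrite -scalerA -scalerDr (sublinearZ _ q_sub a0) mulrBr mulrA.
Qed.

(** The pointwise infimum works; it is finite because every member is at least [- p (- y)] at [y].
    For subadditivity, the smaller of two members serves both summands. *)
Lemma sublinear_chain_inf p (A : set (V -> R)) :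
  A !=set0 -> (forall q, A q -> sublinear q /\ forall y, q y <= p y) ->
  total_on A (fun q r => forall y, q y <= r y) ->
  exists2 r, sublinear r & forall q, A q -> forall y, r y <= q y.
Proof.
move=> [q0 Aq0] Asub Atot; pose r y := inf [set q y | q in A].
have r_le q y : A q -> r y <= q y.
  move=> Aq; apply: ge_inf; last by exists q.
  exists (- p (- y)) => _ [s As <-]; have [s_sub s_le] := Asub s As.
  by rewrite (le_trans _ (sublinearN y s_sub))// lerN2.
have le_r c y : (forall q, A q -> c <= q y) -> c <= r y.
  move=> cq; apply: lb_le_inf; first by exists (q0 y), q0.
  by move=> _ [q Aq <-]; exact: cq.
exists r => [|q Aq y]; last exact: r_le.
split=> [x y|a x].
  rewrite -lerBlDr; apply: (le_r) => s As.
  rewrite lerBlDr [leRHS]addrC -lerBlDr; apply: (le_r) => t At; rewrite lerBlDr.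
  have [st|ts] := Atot s t As At.
    have [[sD _] _] := Asub s As.
    by rewrite (le_trans (r_le s _ As))// (le_trans (sD x y))// addrC lerD2r.
  have [[tD _] _] := Asub t At.
  by rewrite (le_trans (r_le t _ At))// (le_trans (tD x y))// addrC lerD2l.
rewrite le_eqVlt => /orP[/eqP<-|a0].
  have [[_ qZ] _] := Asub q0 Aq0.
  rewrite mul0r (le_trans (r_le q0 _ Aq0))//.
  by have := qZ 0 x (lexx 0); rewrite mul0r.
rewrite -ler_pdivrMl//; apply: (le_r) => s As; rewrite ler_pdivrMl//.
by have [[_ sZ] _] := Asub s As; rewrite (le_trans (r_le s _ As))// sZ// ltW.
Qed.

Lemma minimal_sublinear p : sublinear p ->
  exists2 q, sublinear q /\ (forall y, q y <= p y) &
    forall r, sublinear r -> (forall y, r y <= q y) -> r = q.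
Proof.
move=> p_sub; pose D := [set q | sublinear q /\ forall y, q y <= p y].
pose T := {q : V -> R | `[< D q >]}.
have Dp : `[< D p >] by apply/asboolP.
(* The order is reversed, so that a maximal element for Zorn's lemma is a minimal functional. *)
pose below (q r : T) := `[< forall y, sval r y <= sval q y >].
have [| | |B Btot|[q Dq] q_min] := @Zorn T below.
- by move=> q; apply/asboolP.
- move=> q r s /asboolP qr /asboolP rs; apply/asboolP => y.
  exact: le_trans (rs y) (qr y).
- move=> [q Dq] [r Dr] /asboolP/= qr /asboolP/= rq; apply: eq_exist => /=.
  by apply/funext => y; apply/eqP; rewrite eq_le qr rq.
- have [[b Bb]|] := pselect (B !=set0); last first.
    (* The empty chain is bounded by [p] itself. *)
    by move=> B0; exists (exist _ p Dp) => s Bs; case: B0; exists s.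
  have [| | |r r_sub r_le] := @sublinear_chain_inf p [set sval s | s in B].
  + by exists (sval b), b.
  + by move=> _ [s Bs <-]; exact/asboolP/(valP s).
  + move=> _ _ [s Bs <-] [t Bt <-].
    by have [/asboolP|/asboolP] := Btot _ _ Bs Bt; [right|left].
  have Dr : `[< D r >].
    apply/asboolP; split=> // y; have /asboolP[_ b_le] := valP b.
    by apply: le_trans (b_le y); apply: r_le; exists b.
  by exists (exist _ r Dr) => s Bs; apply/asboolP => y; apply: r_le; exists s.
- have /asboolP[q_sub q_le] := Dq; exists q => // r r_sub r_le.
  have Dr : `[< D r >].
    by apply/asboolP; split=> // y; exact: le_trans (r_le y) (q_le y).
  have qr : below (exist _ q Dq) (exist _ r Dr) by apply/asboolP.
  by have /(congr1 sval) := q_min _ qr.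
Qed.

Lemma hahn_banach p v : sublinear p ->
  exists2 u : {scalar V}, (forall y, u y <= p y) & u v = p v.
Proof.
move=> p_sub.
(* Minimizing below [shave p v] rather than [p] already forces the value at [v], since
   [shave p v (- v) <= - p v]. *)
have [q [q_sub q_le] q_min] := minimal_sublinear (sublinear_shave v p_sub).
have [qD qZ] := q_sub.
(* By minimality [shave q x] equals [q], and its value at [- x] is at most [- q x]. Oddness then
   turns subadditivity into additivity. *)
have qN x : q (- x) = - q x.
  apply/eqP; rewrite eq_le; apply/andP; split.
    rewrite -{1}(q_min (shave q x)); first exact: shaveN.
      exact: sublinear_shave.
    by move=> y; exact: shave_le_id.
  by rewrite lerNl sublinearN.
have qDE x y : q (x + y) = q x + q y.
  apply/eqP; rewrite eq_le qD/=.
  by have := qD (- x) (- y); rewrite -opprD !qN => ?; lra.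
have qZE a x : q (a *: x) = a * q x.
  have [a0|a0|->] := ltgtP a 0; last 1 first.
  - by have := qDE 0 0; rewrite scale0r addr0 mul0r => ?; lra.
  - rewrite -[a]opprK scaleNr qN (sublinearZ _ q_sub) ?oppr_gt0//.
    by rewrite [RHS]mulNr.
  - exact: sublinearZ.
have q_lin : scalar q by move=> a x y /=; rewrite qDE qZE.
pose u : {scalar V} := HB.pack q (GRing.isLinear.Build _ _ _ _ q q_lin).
have up y : u y <= p y by exact: le_trans (q_le y) (shave_le_id v y p_sub).
exists u => //; apply/eqP; rewrite eq_le up/=.
have := le_trans (q_le (- v)) (shaveN v p_sub).
by rewrite qN lerN2.
Qed.

End Sublinear.

(** * Complex spaces as real spaces, under an alias that keeps the two module structures apart *)

Definition restrict_scalars (R : realType) (V : lmodType R[i]) : Type := V.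

Section RestrictScalars.
Variables (R : realType) (V : lmodType R[i]).

HB.instance Definition _ := GRing.Zmodule.on (restrict_scalars V).

Let scale (a : R) (x : restrict_scalars V) : restrict_scalars V :=
  a%:C *: (x : V).

Let scaleA a b x : scale a (scale b x) = scale (a * b) x.
Proof. by rewrite /scale scalerA rmorphM. Qed.

Let scale1 : left_id 1 scale.
Proof. by move=> x; rewrite /scale scale1r. Qed.

Let scaleDr : right_distributive scale +%R.
Proof. by move=> a x y; rewrite /scale scalerDr. Qed.

Let scaleDl x : {morph scale^~ x : a b / a + b}.
Proof. by move=> a b; rewrite /scale rmorphD scalerDl. Qed.

HB.instance Definition _ := GRing.Zmodule_isLmodule.Build R
  (restrict_scalars V) scaleA scale1 scaleDr scaleDl.

Lemma restrict_scalarsZ (a : R) (x : V) :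
  a *: (x : restrict_scalars V) = a%:C *: x.
Proof. by []. Qed.

End RestrictScalars.

(** * Bounded functionals that do not vanish at a given vector *)

Lemma bounded_functional_real (R : realType) (X : normedModType R) (v : X) :
  v != 0 -> exists2 f : {linear X -> R^o},
    f v != 0 & forall y, `|f y| <= `|y|.
Proof.
move=> v0; pose p (y : X) : R := `|y|.
have p_sub : sublinear p.
  split=> [x y|a x a0]; first exact: ler_normD.
  by rewrite /p normrZ ger0_norm.
have [u u_le uv] := hahn_banach v p_sub.
have u_lin : linear (u : X -> R^o) by move=> a x y; rewrite linearP.
pose f : {linear X -> R^o} := HB.pack (u : X -> R^o)
  (GRing.isLinear.Build _ _ _ _ (u : X -> R^o) u_lin).
exists f => [|y]; first by rewrite /f /= uv normr_eq0.
rewrite ler_norml (u_le y) andbT lerNl.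
by have := u_le (- y); rewrite linearN /p normrN.
Qed.

(** A real functional dominated by the norm is the real part of a complex one. The factor [2] comes
    from bounding real and imaginary parts separately. *)
Lemma bounded_functional_complex (R : realType) (X : normedModType R[i])
    (v : X) :
  v != 0 -> exists2 f : {linear X -> R[i]^o},
    f v != 0 & forall y, `|f y| <= 2 * `|y|.
Proof.
move=> v0; pose p (y : restrict_scalars X) : R := complex.Re `|y : X|.
have pE y : (p y)%:C = `|y : X| by rewrite RRe_real// normr_real.
have p_sub : sublinear p.
  split=> [x y|a x a0]; rewrite -lecR.
    by rewrite rmorphD/= !pE; exact: ler_normD.
  rewrite rmorphM/= !pE restrict_scalarsZ normrZ ger0_norm//.
  by rewrite ler0c.
have [u u_le uv] := hahn_banach (v : restrict_scalars X) p_sub.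
have uZ (a : R) (y : X) : u (a%:C *: y) = a * u y.
  by rewrite -restrict_scalarsZ linearZ.
have uN (y : X) : u (- y) = - u y by rewrite linearN.
have uD (y z : X) : u (y + z) = u y + u z by rewrite linearD.
have u_norm (y : X) : `|u y| <= p y.
  rewrite ler_norml u_le andbT lerNl -linearN (le_trans (u_le _))//.
  by rewrite /p normrN.
have uC a b (y : X) : u ((a +i* b)%C *: y) = a * u y + b * u ('i%C *: y).
  have -> : (a +i* b)%C = a%:C + b%:C * 'i%C by simpc.
  by rewrite scalerDl -scalerA uD !uZ.
(* Complex linearity forces this imaginary part once the real part is [u]. *)
pose g (y : X) : R[i]^o := (u y -i* u ('i%C *: y))%C.
have g_lin : linear g.
  move=> [a b] x y; rewrite /g scalerDr !uD scalerA mulrC -scalerA.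
  rewrite (uC a b x) (uC a b ('i%C *: x)).
  have -> : 'i%C *: ('i%C *: x) = - x.
    by rewrite scalerA -expr2 sqr_i scaleN1r.
  rewrite uN [in RHS]/GRing.scale/=; simpc.
  by congr (_ +i* _)%C; ring.
pose f : {linear X -> R[i]^o} := HB.pack g
  (GRing.isLinear.Build _ _ _ _ g g_lin).
have normC_real (r : R) : `|r%:C| = `|r|%:C.
  by rewrite normc_def/= expr0n addr0 sqrtr_sqr.
exists f => [|y].
  apply/eqP => /(congr1 (@complex.Re R))/=; rewrite uv => /eqP.
  by rewrite -(inj_eq (@complexI R)) pE normr_eq0 (negbTE v0).
have -> : f y = (u y)%:C - (u ('i%C *: y))%:C * 'i%C by rewrite /f/= /g; simpc.
rewrite (le_trans (ler_normB _ _))// normrM complexiE normCi mulr1 !normC_real.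
rewrite mulr_natl mulr2n lerD// -pE lecR ?u_norm//.
rewrite (le_trans (u_norm _))// -lecR !pE normrZ.
by rewrite normCi mul1r.
Qed.

(** * Real parts of scalars, uniformly in both fields *)

Section Scalars.
Variables (R : realType) (s : scalars).
Local Notation K := (scalar_field R s).
Implicit Types a b : K.

Lemma re_le a b : a <= b -> re a <= re b.
Proof. by case: s a b => //= a b; rewrite lecE => /andP[]. Qed.

Lemma re_lt a b : a < b -> re a < re b.
Proof. by case: s a b => //= a b; rewrite ltcE => /andP[]. Qed.

Lemma re_nat n : re (n%:R : K) = n%:R.
Proof.
case: s => //=.
by elim: n => // n IHn; rewrite !mulrS -IHn raddfD.
Qed.

Lemma re0 : re (0 : K) = 0.
Proof. exact: (re_nat 0). Qed.

(** In the complex case [0 <= a] forces the imaginary part of [a] to be zero. *)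
Lemma reM a b : 0 <= a -> re (a * b) = re a * re b.
Proof.
case: s a b => //= -[a1 a2] [b1 b2]; rewrite lecE /= => /andP[/eqP-> _].
by simpc.
Qed.

Lemma reV a : 0 < a -> re a^-1 = (re a)^-1.
Proof.
move=> a0; have ra0 : 0 < re a by have := re_lt a0; rewrite re0.
apply: (mulfI (lt0r_neq0 ra0)); rewrite -reM ?ltW// !mulfV ?lt0r_neq0//.
exact: re_nat 1%N.
Qed.

Lemma re_le_norm a : re a <= re `|a|.
Proof.
case: s a => /= [a|a]; first exact: ler_norm.
have := normc_ge_Re a; rewrite lecE => /andP[_]; exact/le_trans/ler_norm.
Qed.

End Scalars.

(** * Bounded functionals over either field, and one that vanishes at [x] *)

Lemma functionalZ (K : pzRingType) (V : lmodType K) (f : {linear V -> K^o}) a x :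
  f (a *: x) = a * f x.
Proof. by rewrite linearZ. Qed.

Lemma bounded_functional (R : realType) (s : scalars)
    (X : normedModType (scalar_field R s)) (v : X) :
  v != 0 -> exists2 f : {linear X -> (scalar_field R s)^o},
    f v != 0 & forall y, `|f y| <= 2 * `|y|.
Proof.
case: s X v => X v v0; last exact: bounded_functional_complex.
have [f fv f_le] := @bounded_functional_real R X v v0.
exists f => // y; rewrite (le_trans (f_le y))// mulr_natl mulr2n.
by rewrite lerDl normr_ge0.
Qed.

(** The combination [f1 x * f2 - f2 x * f1] vanishes at [x]. It is nonzero because [f2] is chosen
    nonzero at a vector of the kernel of [f1], where only the first term survives. *)
Lemma bounded_functional_vanishing (R : realType) (s : scalars)
    (X : completeNormedModType (scalar_field R s)) (x : X) :
  dim_gt X 1 -> x != 0 -> exists f : {linear X -> (scalar_field R s)^o},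
    exists M : scalar_field R s,
    [/\ f x = 0, exists z, f z != 0, 0 < M & forall y, `|f y| <= M * `|y|].
Proof.
move=> [v v_indep] x0.
have [f1 f1x f1_le] := bounded_functional x0.
(* Otherwise, as [f1 x] is nonzero, both vectors [v i] are multiples of [x], against
   independence. *)
have [i w0] : exists i, f1 x *: v i - f1 (v i) *: x != 0.
  apply/existsP; apply: contraT; rewrite negb_exists => /forallP all0.
  have {}all0 i : f1 x *: v i = f1 (v i) *: x.
    by apply/eqP; rewrite -subr_eq0; have := all0 i; rewrite negbK.
  pose a (i : 'I_2) := if i == 0 then f1 (v 1) else - f1 (v 0).
  have /v_indep a0 : \sum_(i < 2) a i *: v i = 0.
    apply: (scalerI f1x); rewrite scaler0 big_ord_recl big_ord1 /a /=.
    rewrite scalerDr !scalerA ![f1 x * _]mulrC -!scalerA !all0.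
    have -> : lift ord0 ord0 = 1 :> 'I_2 by exact/val_inj.
    by rewrite !scalerA mulNr scaleNr mulrC subrr.
  (* Independence gives [f1 (v 0) = 0], so the multiple of [x] equal to [f1 x *: v 0] is zero. The
     coefficients [b], equal to 1 and 0, then contradict independence. *)
  have v0 : v 0 = 0.
    have := all0 0; have /eqP := a0 1; rewrite /a/= oppr_eq0 => /eqP->.
    by rewrite scale0r => /eqP; rewrite scaler_eq0 (negPf f1x) => /eqP.
  pose b (i : 'I_2) : scalar_field R s := (i == 0)%:R.
  have /v_indep/(_ 0)/eqP : \sum_(i < 2) b i *: v i = 0.
    by rewrite big_ord_recl big_ord1 /b /= v0 scaler0 scale0r addr0.
  by rewrite /b oner_eq0.
have [f2 f2y f2_le] := bounded_functional w0.
set y := _ - _ in f2y.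
have f1y : f1 y = 0 by rewrite linearB 2!functionalZ mulrC subrr.
have f_lin : linear (fun z => f1 x * f2 z - f2 x * f1 z : (scalar_field R s)^o).
  move=> a z t; rewrite (linearD f1) (linearD f2) !(functionalZ f1) !(functionalZ f2).
  rewrite [a *: _](_ : _ = a * (f1 x * f2 z - f2 x * f1 z))//; ring.
pose f : {linear X -> (scalar_field R s)^o} := HB.pack
  (fun z => f1 x * f2 z - f2 x * f1 z : (scalar_field R s)^o)
  (GRing.isLinear.Build _ _ _ _ _ f_lin).
exists f, (2 * `|f1 x| + 2 * `|f2 x|); split => [| | |z].
- by rewrite /f /= mulrC subrr.
- by exists y; rewrite /f/= f1y mulr0 subr0 mulf_neq0.
- by rewrite ltr_pwDl ?mulr_ge0 ?mulr_gt0 ?normr_gt0.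
- rewrite /f/= (le_trans (ler_normB _ _))// !normrM mulrDl.
  by rewrite lerD// -mulrA mulrCA ler_wpM2l.
Qed.

(** * The real-valued norm, continuity of bounded functionals and their suprema on the ball *)

Lemma rnormZ (R : realType) (s : scalars)
    (X : completeNormedModType (scalar_field R s)) (a : scalar_field R s)
    (x : X) :
  rnorm (a *: x) = re `|a| * rnorm x.
Proof. by rewrite /rnorm normrZ reM. Qed.

Lemma bounded_functional_continuous (K : numFieldType) (X : normedModType K)
    (f : {linear X -> K^o}) (M : K) :
  0 <= M -> (forall y, `|f y| <= M * `|y|) -> continuous f.
Proof.
move=> M0 f_le; apply: bounded_linear_continuous.
apply/bounded_funP => r; exists (M * r) => y yr.
by rewrite (le_trans (f_le y))// ler_wpM2l.
Qed.

Lemma sup_functional_gt0 (R : realType) (s : scalars)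
    (X : completeNormedModType (scalar_field R s))
    (f : {linear X -> (scalar_field R s)^o}) (z : X) :
  has_ubound [set re (f y) | y in unit_ball] -> f z != 0 ->
  0 < sup [set re (f y) | y in unit_ball].
Proof.
move=> f_ub fz.
have z0 : z != 0 by apply: contraNneq fz => ->; rewrite linear0.
(* Normalizing [z] and rotating it by [|f z| / f z] makes the value of [f] real and positive. *)
pose y := (`|f z| / f z / `|z|) *: z.
have fy : f y = `|f z| / `|z|.
  by rewrite functionalZ mulrAC divfK.
have y_ball : unit_ball y.
  rewrite /unit_ball /= /rnorm normrZ !normrM !normfV !normr_id.
  by rewrite mulfV ?normr_eq0// mul1r mulVf ?normr_eq0// (re_nat _ _ 1).
apply: lt_le_trans (ub_le_sup f_ub _); last by exists y.
by rewrite fy -(re0 R s) re_lt// divr_gt0 ?normr_gt0.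
Qed.

Theorem proposition4p15 (R : realType) (s : scalars)
  (X : completeNormedModType (scalar_field R s)) (x : X) :
  dim_gt X 1 -> unit_sphere x -> LUR_point x -> ~ AD_point x.
Proof.
move=> dimX x1 [_ x_lur] [_ x_ad].
have x0 : x != 0.
  apply/eqP => x0; move: x1; rewrite x0 /unit_sphere /= /rnorm normr0 re0.
  by move/eqP; rewrite eq_sym oner_eq0.
have [f [M [fx [z fz] M0 f_le]]] := bounded_functional_vanishing dimX x0.
have rM0 : 0 < re M by rewrite -(re0 R s) re_lt.
have re_f_le y : re `|f y| <= re M * rnorm y.
  by rewrite /rnorm -(reM _ (ltW M0)); exact/re_le/f_le.
have f_ub : has_ubound [set re (f y) | y in unit_ball].
  exists (re M) => _ [y y_ball <-].
  rewrite (le_trans (re_le_norm _))// (le_trans (re_f_le y))//.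
  by rewrite ler_piMr// ltW.
pose sigma := sup [set re (f y) | y in unit_ball].
have sigma0 : 0 < sigma by exact: sup_functional_gt0 f_ub fz.
(* The tolerance, multiplied by the bound [re M] of [f], is [sigma / 2]: exactly the level that
   [re (f y)] exceeds on the slice of depth [sigma / 2]. *)
have [|delta delta0 x_near] := x_lur (sigma / 2 / re M).
  by rewrite !divr_gt0.
have /x_ad sup2 : is_slice (slice f (sigma / 2)).
  exists f, (sigma / 2); split => //; last by rewrite divr_gt0.
    exact: bounded_functional_continuous (ltW M0) f_le.
  by exists z.
(* Halving for the midpoint turns [2 - 2 * delta] into the LUR threshold [1 - delta]. *)
have [_ [y [y_ball fy] <-]] :
    exists2 m, [set max_rotation x y | y in slice f (sigma / 2)] m
             & 2 - 2 * delta < m.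
  apply: sup_gt; last by rewrite sup2; lra.
  (* An empty slice would give the default supremum [0] instead of [2]. *)
  apply/set0P/eqP => S0; move: sup2; rewrite S0 sup0 => /eqP.
  by rewrite eq_sym pnatr_eq0.
move=> /sup_gt[|_ [theta theta1 <-]].
  by exists (rnorm (x + 1 *: y)), 1 => //; exact: normr1.
move=> xy_gt.
have rtheta : re `|theta| = 1 by rewrite theta1 (re_nat _ _ 1).
have ty_ball : unit_ball (theta *: y).
  by rewrite /unit_ball /= rnormZ rtheta mul1r.
have /(x_near _ ty_ball) : 1 - delta < rnorm (2^-1 *: (x + theta *: y)).
  rewrite rnormZ ger0_norm ?invr_ge0// reV// (re_nat _ _ 2) ltr_pdivlMl//.
  by rewrite mulrBr mulr1.
rewrite ler_pdivlMr// mulrC => /(le_trans (re_f_le _)).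
(* Since [f x = 0] and [theta] is unimodular, [f (x - theta *: y)] has the modulus of [f y]. *)
rewrite linearB fx sub0r normrN functionalZ normrM theta1 mul1r.
move=> /(le_trans (re_le_norm _)).
move: fy; rewrite -/sigma; lra.
Qed.
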